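(* Let $\mathcal B$ be a locally finite thick affine building of type $\widetilde A_2$ and let $\Gamma$ be a group of type rotating automorphisms of $\mathcal B$ acting freely and transitively on the vertex set of $\mathcal B$. Let $\mathcal T$ be the associated set of triangle labellings, and let $M_1,M_2$ be the associated transition matrices with rows and columns indexed by $\mathcal T$. Then the associated 2-dimensional subshift is irreducible; that is, for all $\alpha,\beta\in\mathcal T$ there exist integers $r,s>0$ such that $(M_1^rM_2^s)(\alpha,\beta)>0$.
   Context: Building. Each vertex $v$ of $\mathcal B$ has a type $\tau(v)\in\mathbb Z/3\mathbb Z$, each chamber (triangle) having exactly one vertex of each type. An automorphism $\alpha$ of $\mathcal B$ is type rotating if there is $i\in\mathbb Z/3\mathbb Z$ with $\tau(\alpha(v))=\tau(v)+i$ for all vertices $v$. Labels. Fix a base vertex $o$ and identify the vertex set of $\mathcal B$ with $\Gamma$ via $g\leftrightarrow g\,o$. Let $P\subset\Gamma$ be the (finite) set of $x\in\Gamma$ such that $x\,o$ is adjacent to $o$ and $\tau(x\,o)=\tau(o)+1$. The neighbours of a vertex $g$ are the vertices $gx$ and $gx^{-1}$ with $x\in P$. Put $\mathcal T=\{(x,y,z)\in P^3: xyz=1\}$; its elements are called triangle labellings. Charts. Make $\mathbb Z^2$ the vertex set of the triangulated plane in which $m,m'$ are adjacent iff $m-m'\in\{\pm(1,0),\pm(0,1),\pm(1,-1)\}$ (the tiling by equilateral triangles). An apartment chart is a map $\varphi:\mathbb Z^2\to\Gamma$ that is a simplicial isomorphism from this triangulated plane onto an apartment of $\mathcal B$. Say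 that the triangle of $\varphi$ based at $m\in\mathbb Z^2$ has labelling $(a_1,a_2,a_3)\in\mathcal T$ if $\varphi(m+(0,1))=\varphi(m)a_1^{-1}$ and $\varphi(m+(1,0))=\varphi(m)a_2$ (then automatically $\varphi(m+(1,0))a_3=\varphi(m+(0,1))$). Transition matrices. $M_1,M_2$ have entries in $\{0,1\}$. For $\alpha,\beta\in\mathcal T$, $M_1(\alpha,\beta)=1$ iff there is an apartment chart $\varphi$ whose triangle based at $(0,0)$ has labelling $\alpha$ and whose triangle based at $(1,0)$ has labelling $\beta$. Likewise $M_2(\alpha,\gamma)=1$ iff there is an apartment chart $\varphi$ whose triangle based at $(0,0)$ has labelling $\alpha$ and whose triangle based at $(0,1)$ has labelling $\gamma$. *)

(* Defs.v *)
From HB Require Import structures.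
From mathcomp Require Import all_boot all_order all_algebra finmap.
From mathcomp Require Import all_classical.

Set Implicit Arguments.
Unset Strict Implicit.
Unset Printing Implicit Defensive.

Import Order.TTheory GRing.Theory Num.Theory.

Local Open Scope classical_set_scope.

(* A simplicial complex is given by its set of (nonempty, finite) simplices;
   the vertices are the points v such that [set v] is a simplex. *)
Definition vertices (V : Type) (K : set (set V)) : set V :=
  [set v | K [set v]].

Definition simplicial_complex (V : Type) (K : set (set V)) : Prop :=
  (forall S, K S -> finite_set S /\ S !=set0) /\
  (forall S T, K S -> T `<=` S -> T !=set0 -> K T).

Definition adjacent (V : Type) (K : set (set V)) (u v : V) : Prop :=
  u <> v /\ K [set u; v].

Definition chamber (V : Type) (K : set (set V)) (C : set V) : Prop :=
  K C /\ forall S, K S -> C `<=` S -> S = C.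

(* f need only be meaningful on the vertices of K. *)
Definition complex_iso (V W : Type) (K : set (set V)) (L : set (set W))
    (f : V -> W) : Prop :=
  set_inj (vertices K) f /\ [set f @` S | S in K] = L.

Definition lattice_adj (m m' : int * int) : bool :=
  (m - m')%R \in [:: ((1, 0) : int * int); (-1, 0); (0, 1); (0, -1);
                     (1, -1); (-1, 1)]%R.

(* The Coxeter complex of type A~_2.  It is the clique complex of its graph:
   any three mutually adjacent vertices bound a tile, and no four vertices are
   mutually adjacent. *)
Definition tiled_plane : set (set (int * int)) :=
  [set S | S !=set0 /\
     forall m m', S m -> S m' -> m = m' \/ lattice_adj m m'].

Record A2_building (V : Type) := A2Building {
  simplices :> set (set V);
  apartments : set (set (set V));
  building_complex : simplicial_complex simplices;
  building_vertices : forall v, simplices [set v];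
  apartment_sub : forall A, apartments A -> A `<=` simplices;
  apartment_plane : forall A, apartments A ->
    exists f, complex_iso tiled_plane A f;
  apartment_common : forall S T, simplices S -> simplices T ->
    exists A, [/\ apartments A, A S & A T];
  apartment_iso : forall A A' S T, apartments A -> apartments A' ->
    A S -> A T -> A' S -> A' T ->
    exists2 f, complex_iso A A' f & forall v, S v \/ T v -> f v = v
}.

(* The panels of a building of type A~_2 are its edges. *)
Definition thick (V : Type) (B : A2_building V) : Prop :=
  forall u v, adjacent B u v ->
    (`I_3 #<= [set C | chamber B C /\ [set u; v] `<=` C])%card.

Definition locally_finite (V : Type) (B : A2_building V) : Prop :=
  forall v, finite_set [set S | simplices B S /\ S v].

Definition type_function (V : Type) (B : A2_building V) (tau : V -> 'Z_3) :
    Prop :=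
  forall C, chamber B C -> forall i, exists! v, C v /\ tau v = i.

Definition automorphism (V : Type) (B : A2_building V) (f : V -> V) : Prop :=
  bijective f /\ forall S, simplices B S <-> simplices B (f @` S).

Definition type_rotating (V : Type) (tau : V -> 'Z_3) (f : V -> V) : Prop :=
  exists i, forall v, (tau (f v) = tau v + i)%R.

Definition left_action (G : groupType) (V : Type) (act : G -> V -> V) : Prop :=
  (forall v, act 1%g v = v) /\
  (forall g h v, act (g * h)%g v = act g (act h v)).

Definition free_action (G : groupType) (V : Type) (act : G -> V -> V) : Prop :=
  forall g v, act g v = v -> g = 1%g.

Definition transitive_action (G : groupType) (V : Type) (act : G -> V -> V) :
    Prop :=
  forall u v, exists g, act g u = v.

Definition generators (G : groupType) (V : Type) (B : A2_building V)
    (tau : V -> 'Z_3) (act : G -> V -> V) (o : V) : set G :=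
  [set x | adjacent B (act x o) o /\ (tau (act x o) = tau o + 1)%R].

Definition triangle_labellings (G : groupType) (V : Type) (B : A2_building V)
    (tau : V -> 'Z_3) (act : G -> V -> V) (o : V) : set (G * G * G) :=
  let P := generators B tau act o in
  [set a | [/\ P a.1.1, P a.1.2, P a.2 & (a.1.1 * a.1.2 * a.2 = 1)%g]].

(* The set of triangle labellings as a finite type; see labellingE. *)
Definition labelling (G : groupType) (V : Type) (B : A2_building V)
    (tau : V -> 'Z_3) (act : G -> V -> V) (o : V) : finType :=
  fset_set (triangle_labellings B tau act o).

Lemma generators_finite (G : groupType) (V : Type) (B : A2_building V)
    (tau : V -> 'Z_3) (act : G -> V -> V) (o : V) :
  locally_finite B -> left_action act -> free_action act ->
  finite_set (generators B tau act o).
Proof.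
move=> /(_ o) fin [act1 actM] free.
apply: (@sub_finite_set _ _
  ((fun x => [set act x o; o]) @^-1` [set S | simplices B S /\ S o])).
  by move=> x [[_ Bx] _]; split=> //; right.
apply: finite_preimage fin => x y _ _ exy.
have inj g h : act g o = act h o -> g = h.
  move=> e; have /free : act (h^-1 * g)%g o = o.
    by rewrite actM e -actM mulVg act1.
  by move=> /(congr1 (fun k => h * k)%g); rewrite mulVKg mulg1.
have : [set act y o; o] (act x o) by rewrite -exy; left.
have : [set act x o; o] (act y o) by rewrite exy; left.
case=> [/esym/inj //|yo]; case=> [/inj //|xo].
by apply: inj; rewrite xo yo.
Qed.

Lemma triangle_labellings_finite (G : groupType) (V : Type)
    (B : A2_building V) (tau : V -> 'Z_3) (act : G -> V -> V) (o : V) :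
  locally_finite B -> left_action act -> free_action act ->
  finite_set (triangle_labellings B tau act o).
Proof.
move=> lf la fa; have Pfin := @generators_finite G V B tau act o lf la fa.
apply: sub_finite_set (finite_setX (finite_setX Pfin Pfin) Pfin).
by move=> a [].
Qed.

Lemma labellingE (G : groupType) (V : Type) (B : A2_building V)
    (tau : V -> 'Z_3) (act : G -> V -> V) (o : V) (a : G * G * G) :
  locally_finite B -> left_action act -> free_action act ->
  (exists b : labelling B tau act o, val b = a) <->
  triangle_labellings B tau act o a.
Proof.
move=> lf la fa; have Tfin := @triangle_labellings_finite G V B tau act o lf la fa.
split=> [[b <-]|Ta].
  by have := valP b; rewrite in_fset_set// inE.
have aT : a \in fset_set (triangle_labellings B tau act o).
  by rewrite in_fset_set// inE.
by exists (FSetSub aT).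
Qed.

(* A group element g stands for the vertex act g o. *)
Definition apartment_chart (G : groupType) (V : Type) (B : A2_building V)
    (act : G -> V -> V) (o : V) (phi : int * int -> G) : Prop :=
  exists2 A, apartments B A & complex_iso tiled_plane A (fun m => act (phi m) o).

Definition triangle_label (G : groupType) (phi : int * int -> G)
    (m : int * int) (a : G * G * G) : Prop :=
  (phi (m + (0, 1))%R = phi m * (a.1.1)^-1)%g /\
  (phi (m + (1, 0))%R = phi m * a.1.2)%g.

(* d = (1, 0) gives M_1 and d = (0, 1) gives M_2. *)
Definition transition_mx (G : groupType) (V : Type) (B : A2_building V)
    (tau : V -> 'Z_3) (act : G -> V -> V) (o : V) (d : int * int) :
    'M[int]_#|labelling B tau act o| :=
  \matrix_(i, j) Posz (nat_of_bool `[< exists phi,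
     [/\ apartment_chart B act o phi,
         triangle_label phi (0, 0)%R (val (enum_val i)) &
         triangle_label phi d (val (enum_val j))] >]).

(* Main.v *)
Require Import Defs.
From HB Require Import structures.
From mathcomp Require Import all_boot all_order all_algebra finmap.
From mathcomp Require Import all_classical.
From mathcomp Require Import ring.

(* The link of a vertex is a finite projective plane, so every edge lies in the
   same number q + 1 >= 3 of triangles. A transition of M_1 or M_2 crosses two
   edges in succession, and counted with multiplicity each labelling has q^2
   successors and q^2 predecessors. In a finite directed graph with equal in-
   and out-weights reachability is symmetric, so it is enough to connect the
   labellings by undirected steps. Two labellings with a common coordinate have
   a common successor or predecessor, a labelling is connected to its cyclic
   rotations, and any two points of a projective plane lie on a line. Finally,
   completing the hexagon around a vertex turns an M_2 step followed by an M_1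
   step into an M_1 step followed by an M_2 step, so that the steps of a path
   can be sorted. *)

Set Implicit Arguments.
Unset Strict Implicit.
Unset Printing Implicit Defensive.

(** * Balanced graphs *)

Definition balanced (T : finType) (w : T -> T -> nat) (k : nat) : Prop :=
  (forall a, \sum_b w a b = k) /\ (forall b, \sum_a w a b = k).

(** A transition crosses two edges; the number of its intermediate triangles is a weight of this
    composite form. *)
Lemma balanced_comp (T : finType) (w w' : T -> T -> nat) (k k' : nat) :
  balanced w k -> balanced w' k' ->
  balanced (fun a c => \sum_b w a b * w' b c) (k * k').
Proof.
move=> [wr wc] [wr' wc']; split=> [a|c]; rewrite exchange_big /=.
  under eq_bigr do rewrite -big_distrr /= wr'.
  by rewrite -big_distrl /= wr.
under eq_bigr do rewrite -big_distrl /= wc.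
by rewrite -big_distrr /= wc'.
Qed.

Lemma balanced_bij (T : finType) (w : T -> T -> nat) (k : nat) (f g : T -> T) :
  bijective f -> bijective g -> balanced w k ->
  balanced (fun a b => w (f a) (g b)) k.
Proof.
move=> fb gb [wr wc]; split=> [a|b].
  by rewrite -(wr (f a)) [RHS](reindex g) //; apply: onW_bij.
by rewrite -(wc (g b)) [RHS](reindex f) //; apply: onW_bij.
Qed.

(* A forward closed set emits and receives the same total weight, so no edge
   enters it from outside. *)
Lemma balanced_connect_sym (T : finType) (w : T -> T -> nat) (k : nat) :
  balanced w k -> connect_sym (fun a b => 0 < w a b).
Proof.
move=> [wr wc]; set e := fun a b : T => _.
have step a b : e a b -> connect e b a.
  move=> ab; pose S := [pred c | connect e b c].
  have inner x : x \in S -> \sum_(y in S) w x y = k.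
    move=> Sx; rewrite -(wr x) [RHS](bigID (mem S)) /= [X in _ + X]big1 ?addn0 //.
    move=> y Sy; apply/eqP; rewrite -leqn0 leqNgt; apply: contra Sy => xy.
    exact: connect_trans Sx (connect1 xy).
  have e1 : \sum_(y in S) \sum_(x in S) w x y = #|S| * k.
    by rewrite exchange_big /= (eq_bigr _ inner) sum_nat_const.
  have e2 : \sum_(y in S) \sum_x w x y = #|S| * k.
    by under eq_bigr do rewrite wc; rewrite sum_nat_const.
  have e3 : \sum_(y in S) \sum_(x | x \notin S) w x y = 0.
    apply/eqP; rewrite -(eqn_add2l (#|S| * k)) addn0 -{1}e1 -{1}e2 -big_split /=.
    by apply/eqP; apply: eq_bigr => y _; rewrite [RHS](bigID (mem S)).
  case Sa: (a \in S) => //; move/eqP: e3.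
  rewrite sum_nat_eq0 => /forall_inP/(_ b (connect0 _ _)).
  rewrite sum_nat_eq0 => /forall_inP/(_ a); rewrite Sa => /(_ isT).
  by move/eqP=> w0; move: ab; rewrite /e w0.
have half a b : connect e a b -> connect e b a.
  case/connectP=> p; elim: p a => [|c p IH] a /=; first by move=> _ ->.
  case/andP=> ac cp bE; exact: connect_trans (IH _ cp bE) (step _ _ ac).
by move=> a b; apply/idP/idP; apply: half.
Qed.

(** By choice [G] contains a function from [A] to [B], and the second hypothesis makes it injective.
    Projections in the plane are available only as relations. *)
Lemma rel_card_le (T : finType) (G : T -> T -> Prop) (A B : {set T}) :
  (forall a, a \in A -> exists2 b, b \in B & G a b) ->
  (forall a a' b, a \in A -> a' \in A -> b \in B -> G a b -> G a' b -> a = a') ->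
  #|A| <= #|B|.
Proof.
move=> ex inj.
have /choice [f fP] : forall a, exists b, a \in A -> b \in B /\ G a b.
  move=> a; case Aa: (a \in A); last by exists a.
  by have [b Bb Gab] := ex a Aa; exists b.
have fi : {in A &, injective f}.
  move=> a a' Aa Aa' E; have [Bf G1] := fP a Aa; have [_ G2] := fP a' Aa'.
  by apply: (inj a a' (f a)) => //; rewrite E.
rewrite -(card_in_imset fi); apply: subset_leq_card.
by apply/fintype.subsetP => _ /imsetP [a Aa ->]; case: (fP a Aa).
Qed.

(** * Triangle presentations *)

(* The projective plane seen from a vertex, with both points and lines named by
   generators: the triangle t = (y, x, z), with y = e t and x = e (rot (rot t)),
   witnesses that the point x lies on the line y. *)
Record triangle_presentation (P : eqType) (T : finType) (e : T -> P)
    (rot : T -> T) : Prop := TrianglePresentation {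
  rot3 : forall t, rot (rot (rot t)) = t;
  e_inj : forall t u, e t = e u -> e (rot t) = e (rot u) -> t = u;
  join_points : forall t u, e t != e u -> exists t' u',
    [/\ e t' = e u', e (rot (rot t')) = e t & e (rot (rot u')) = e u];
  meet_lines : forall t u, e t != e u -> exists t' u',
    [/\ e (rot (rot t')) = e (rot (rot u')), e t' = e t & e u' = e u];
  join_unique : forall t u t' u', e t = e u -> e t' = e u' ->
    e (rot (rot t)) = e (rot (rot t')) -> e (rot (rot u)) = e (rot (rot u')) ->
    e (rot (rot t)) != e (rot (rot u)) -> e t = e t';
  third_triangle : forall t u, e t = e u ->
    exists d, [/\ e d = e t, d != t & d != u]
}.

(** Distinct triangles sharing the edge named by their first coordinate; a rotation applied
    beforehand selects another edge. *)
Definition panel_adj (P : eqType) (T : finType) (e : T -> P) : rel T :=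
  fun a b => (e a == e b) && (a != b).

(** On a = (a_1, a_2, a_3) the values of [e] at [a], [rot a], [rot (rot a)] are a_1, a_3, a_2. The
    triangle [d] lies between those based at (0,0) and (1,0): d_1 = a_3 and d_3 = b_1. The
    inequalities forbid folding back. *)
Definition step1 (P : eqType) (T : finType) (e : T -> P) (rot : T -> T) :
    rel T :=
  fun a b => [exists d, panel_adj e (rot a) d && panel_adj e (rot d) b].

(** The second crossing is now over the edge from (0,1) to (1,1), so that d_2 = b_2. *)
Definition step2 (P : eqType) (T : finType) (e : T -> P) (rot : T -> T) :
    rel T :=
  fun a b => [exists d, panel_adj e (rot a) d &&
                        panel_adj e (rot (rot d)) (rot (rot b))].

Section TrianglePresentation.
Context (P : eqType) (T : finType) (e : T -> P) (rot : T -> T).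
Context (TP : triangle_presentation e rot).

Let rot_bij : bijective rot.
Proof. by exists (fun t => rot (rot t)) => t; apply: (rot3 TP). Qed.

Let rot2_bij : bijective (fun t => rot (rot t)).
Proof. by exists rot => t; apply: (rot3 TP). Qed.

Let e_inj2 t u : e t = e u -> e (rot (rot t)) = e (rot (rot u)) -> t = u.
Proof.
move=> h h'; rewrite -(rot3 TP t) -(rot3 TP u); congr rot.
by apply: (e_inj TP) h' _; rewrite !(rot3 TP).
Qed.

(* The number of points on the line x, which is also the number of lines
   through the point x. *)
Definition degree (x : P) : nat := #|[set t | e t == x]|.

Lemma degree_dual x : degree x = #|[set t | e (rot (rot t)) == x]|.
Proof.
rewrite -[RHS](card_imset _ (bij_inj rot2_bij)) /degree; apply: eq_card => t.
rewrite !inE; apply/idP/imsetP => [tx|[u]].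
  by exists (rot t); rewrite ?inE (rot3 TP).
by rewrite inE => ux ->.
Qed.

(** * Incidence, and the order of the projective plane *)

Definition on_line (x y : P) : Prop :=
  exists2 t, e t = y & e (rot (rot t)) = x.

Let joinP x x' : x != x' -> (exists t, e t = x) -> (exists t, e t = x') ->
  exists2 y, on_line x y & on_line x' y.
Proof.
move=> ne [t tx] [u ux]; rewrite -tx -ux in ne *.
have [t' [u' [h1 h2 h3]]] := join_points TP ne.
by exists (e t'); [exists t'|exists u'].
Qed.

Let meetP y y' : y != y' -> (exists t, e t = y) -> (exists t, e t = y') ->
  exists2 x, on_line x y & on_line x y'.
Proof.
move=> ne [t tx] [u ux]; rewrite -tx -ux in ne *.
have [t' [u' [h1 h2 h3]]] := meet_lines TP ne.
by exists (e (rot (rot t'))); [exists t'|exists u'].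
Qed.

Let uniqP x x' y y' : on_line x y -> on_line x' y -> on_line x y' ->
  on_line x' y' -> x != x' -> y = y'.
Proof.
move=> [t <- <-] [u u1 <-] [t' t1' t2'] [u' u1' u2'] ne.
by rewrite -t1'; apply: (@join_unique _ _ _ _ TP t u t' u') ne => //; congruence.
Qed.

Let on_lineP x y : on_line x y -> (exists t, e t = x) /\ (exists t, e t = y).
Proof. by move=> [t h1 h2]; split; [exists (rot (rot t))|exists t]. Qed.

(** Projection from [p]: a point of [y] is joined to [p], and a line through [p] is intersected with
    [y]. Both relations are injective because [p] is off [y]. *)
Lemma degree_off p y : (exists t, e t = p) -> (exists t, e t = y) ->
  ~ on_line p y -> degree y = degree p.
Proof.
move=> pP yP off; rewrite (degree_dual p) /degree.
pose G t s := on_line (e (rot (rot t))) (e s).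
apply/eqP; rewrite eqn_leq; apply/andP; split.
- apply: (@rel_card_le T G) => [t|t t' s]; rewrite !inE.
    move=> /eqP ty; have ne : e (rot (rot t)) != p.
      by apply/eqP => E; apply: off; exists t.
    have [l h1 [s sl sp]] := joinP ne (ex_intro _ _ erefl) pP.
    by exists s; rewrite ?inE ?sp // /G sl.
  move=> /eqP ty /eqP ty' /eqP sp h h'; apply: e_inj2; first by rewrite ty.
  apply/eqP; apply/negP => /negP ne; apply: off.
  have <- : e s = y; last by exists s.
  by apply: uniqP h h' _ _ ne; [exists t|exists t'].
- apply: (@rel_card_le T (fun s t => G t s)) => [s|s s' t]; rewrite !inE.
    move=> /eqP sp; have ne : e s != y.
      by apply/eqP => E; apply: off; exists s.
    have [x h1 [t ty tx]] := meetP ne (ex_intro _ _ erefl) yP.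
    by exists t; rewrite ?inE ?ty // /G tx.
  move=> /eqP sp /eqP sp' /eqP ty h h'; apply: e_inj2; last by rewrite sp.
  apply: (@uniqP _ p _ _ h _ h'); [by exists s|by exists s'|].
  by apply/eqP => E; apply: off; exists t.
Qed.

Let third_point y x x' : on_line x y -> on_line x' y ->
  exists2 z, on_line z y & (z != x) && (z != x').
Proof.
move=> [t ty <-] [u uy <-]; have tu : e t = e u by rewrite ty.
have [d [h1 h2 h3]] := third_triangle TP tu.
exists (e (rot (rot d))); first by exists d; rewrite ?h1.
by apply/andP; split; [apply: contra_neq h2|apply: contra_neq h3] => E;
  apply: e_inj2 E; rewrite h1.
Qed.

Let third_line x y y' : on_line x y -> on_line x y' ->
  exists2 z, on_line x z & (z != y) && (z != y').
Proof.
move=> [t <- tx] [u <- ux].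
have tu : e (rot (rot t)) = e (rot (rot u)) by rewrite tx.
have [d [h1 h2 h3]] := third_triangle TP tu.
exists (e (rot d)); first by exists (rot d); rewrite ?(rot3 TP) ?h1.
apply/andP; split; [apply: contra_neq h2|apply: contra_neq h3] => E;
  by apply: (e_inj TP); rewrite ?(rot3 TP) ?h1.
Qed.

(** For distinct lines meeting in [o], choose on each a point other than [o]; a third point of the
    line joining these two is off both lines. If the lines are equal, another line through a point
    of [y] serves as the second one. *)
Let off_two y y' : (exists t, e t = y) -> (exists t, e t = y') ->
  exists2 p, (exists t, e t = p) & ~ on_line p y /\ ~ on_line p y'.
Proof.
suff main z z' : z != z' -> (exists t, e t = z) -> (exists t, e t = z') ->
  exists2 p, (exists t, e t = p) & ~ on_line p z /\ ~ on_line p z'.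
  move=> yP y'P; have [E|] := eqVneq y y'; last by move/main; apply.
  have [t ty] := yP.
  have [z h1 /andP [h2 h3]] := @third_line (e (rot (rot t))) y y
    (ex_intro2 _ _ t ty erefl) (ex_intro2 _ _ t ty erefl).
  rewrite eq_sym in h2.
  by rewrite -E; have [p pP [h4 _]] := main y z h2 yP (on_lineP h1).2; exists p.
move=> ne zP zP'; have [o oz oz'] := meetP ne zP zP'.
have [x xz /andP [xo _]] := third_point oz oz.
have [x' xz' /andP [xo' _]] := third_point oz' oz'.
have xx' : x != x'.
  by apply: contra_neq ne => E; apply: (uniqP xz oz _ oz' xo); rewrite E.
have [l xl xl'] := joinP xx' (on_lineP xz).1 (on_lineP xz').1.
have [p pl /andP [px px']] := third_point xl xl'.
exists p; first exact: (on_lineP pl).1.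
split=> h.
  have lz := uniqP pl xl h xz px; rewrite lz in xl'.
  by move/eqP: ne; apply; apply: (uniqP xl' oz xz' oz').
have lz := uniqP pl xl' h xz' px'; rewrite lz in xl.
by move/eqP: ne; apply; apply: (uniqP xz oz xl oz').
Qed.

(** Both lines have the degree of a single point off both of them. *)
Lemma degree_const t u : degree (e t) = degree (e u).
Proof.
have [p pP [h1 h2]] :=
  off_two (ex_intro _ t erefl) (ex_intro _ u erefl).
by rewrite (degree_off pP _ h1) ?(degree_off pP _ h2) //; eexists.
Qed.

(** * Symmetry of reachability for each kind of step *)

Lemma panel_adjC a b : panel_adj e a b = panel_adj e b a.
Proof. by rewrite /panel_adj eq_sym [a == b]eq_sym. Qed.

Lemma panel_adj_balanced (t0 : T) :
  balanced (fun a b => panel_adj e a b : nat) (degree (e t0)).-1.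
Proof.
have row a : \sum_b panel_adj e a b = (degree (e t0)).-1.
  rewrite (degree_const t0 a) /degree (cardD1 a) inE eqxx add1n /=.
  rewrite -sum1_card [RHS]big_mkcond /=; apply: eq_bigr => b _.
  by rewrite !inE /panel_adj eq_sym [a == b]eq_sym andbC; case: (_ && _).
by split=> // b; under eq_bigr do rewrite panel_adjC; apply: row.
Qed.

(** The number of intermediate triangles [d] is a balanced weight, and [step1] holds exactly where
    it is positive. *)
Lemma step1_connect_sym : connect_sym (step1 e rot).
Proof.
move=> a b; have bal := panel_adj_balanced a.
have idb : bijective (@id T) by exists id.
have := balanced_comp (balanced_bij rot_bij idb bal)
  (balanced_bij rot_bij idb bal).
move/balanced_connect_sym => /(_ a b).
rewrite !(eq_connect (e' := step1 e rot)) //.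
all: move=> x y; rewrite lt0n sum_nat_eq0 negb_forall; apply: eq_existsb => d.
all: by do 2!case: (panel_adj _ _ _).
Qed.

Lemma step2_connect_sym : connect_sym (step2 e rot).
Proof.
move=> a b; have bal := panel_adj_balanced a.
have idb : bijective (@id T) by exists id.
have := balanced_comp (balanced_bij rot_bij idb bal)
  (balanced_bij rot2_bij rot2_bij bal).
move/balanced_connect_sym => /(_ a b).
rewrite !(eq_connect (e' := step2 e rot)) //.
all: move=> x y; rewrite lt0n sum_nat_eq0 negb_forall; apply: eq_existsb => d.
all: by do 2!case: (panel_adj _ _ _).
Qed.

(* The triangles of the given path surround a common vertex and occupy two
   thirds of its link; the new ones are obtained by closing the hexagon. *)
Lemma step21_step12 a c d : step2 e rot a c -> step1 e rot c d ->
  exists2 b, step1 e rot a b & step2 e rot b d.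
Proof.
case/existsP=> D /andP [aD Dc] /existsP [D' /andP [cD' D'd]].
move: (aD) (Dc) (cD') (D'd); rewrite /panel_adj.
move=> /andP [/eqP ea na] /andP [/eqP eD nD].
move=> /andP [/eqP ec nc] /andP [/eqP ed nd].
(* In the link of the common vertex [b1], [c3], [d2] are points and [p], [d1] are lines. They form
   the incidence path [b1], [p], [c3], [d1], [d2], which the line [l] through [b1] and [d2] closes
   to a hexagon. *)
pose b1 := e (rot D); pose p := e (rot (rot D)).
pose c3 := e (rot c); pose d1 := e d; pose d2 := e (rot (rot d)).
have b1p : on_line b1 p by exists (rot (rot D)); last rewrite (rot3 TP).
have c3p : on_line c3 p by exists (rot (rot c)); rewrite ?(rot3 TP).
have c3d1 : on_line c3 d1 by exists (rot D'); rewrite ?(rot3 TP).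
have d2d1 : on_line d2 d1 by exists d.
have b1c3 : b1 != c3.
  by apply: contra_neq nD => E; apply: e_inj2 eD _; rewrite !(rot3 TP).
have pd1 : p != d1.
  apply: contra_neq nc => E; apply: (e_inj TP) ec _.
  by rewrite ed -/d1 -E /p eD.
have c3d2 : c3 != d2.
  apply: contra_neq nd => E; apply: e_inj2 ed _.
  by rewrite (rot3 TP) -ec.
have b1d2 : b1 != d2.
  by apply: contra_neq pd1 => E; apply: (uniqP b1p c3p _ c3d1 b1c3); rewrite E.
have [l b1l d2l] := joinP b1d2 (on_lineP b1p).1 (on_lineP d2d1).1.
have lp : l != p.
  by apply: contra_neq pd1 => E; apply: (uniqP c3p _ c3d1 d2d1 c3d2); rewrite -E.
have ld1 : l != d1.
  by apply: contra_neq pd1 => E; apply: (uniqP b1p c3p _ c3d1 b1c3); rewrite -E.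
case: b1l d2l => s sl sb [E El Ed].
(* The first two coordinates of [s] are [l] and [b1], so this rotation begins with [b1] and borders
   [D]; the triangle [E] lies between it and [d]. *)
exists (rot (rot s)).
  apply/existsP; exists D; rewrite aD /=; apply/andP; split.
    by rewrite sb.
  apply: contra_neq lp => DE.
  by rewrite -sl -(rot3 TP s) -DE.
apply/existsP; exists E; rewrite !(rot3 TP) /panel_adj sl El Ed !eqxx /=.
apply/andP; split.
  by apply: contra_neq b1d2 => DE; rewrite -Ed -DE sb.
apply: contra_neq ld1 => DE; rewrite -El -(rot3 TP E) DE (rot3 TP) //.
Qed.

(** * Sorted paths between arbitrary triangles *)

Definition step12 (a b : T) : Prop :=
  exists2 c, connect (step1 e rot) a c & connect (step2 e rot) c b.

(** The single step of the second kind is carried past the path one step at a time. *)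
Let step2_connect1 a c d : step2 e rot a c -> connect (step1 e rot) c d ->
  exists2 b, connect (step1 e rot) a b & step2 e rot b d.
Proof.
move=> + /connectP [p]; elim: p a c => [|x p IH] a c /=.
  by move=> ac _ ->; exists a.
move=> ac /andP [cx xp] dE.
have [b ab bx] := step21_step12 ac cx.
have [b' bb' b'd] := IH _ _ bx xp dE.
by exists b' => //; apply: connect_trans (connect1 ab) bb'.
Qed.

Let connect2_connect1 a c d : connect (step2 e rot) a c ->
  connect (step1 e rot) c d -> step12 a d.
Proof.
move=> /connectP [p]; elim: p a => [|x p IH] a /=.
  by move=> _ -> ad; exists d.
move=> /andP [ax xp] cE cd; have [b xb bd] := IH _ xp cE cd.
have [b' ab' b'b] := step2_connect1 ax xb.
by exists b' => //; apply: connect_trans (connect1 b'b) bd.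
Qed.

Let step12_refl a : step12 a a. Proof. by exists a. Qed.

Let step12_trans a b c : step12 a b -> step12 b c -> step12 a c.
Proof.
move=> [x ax xb] [y b_y yc]; have [z xz zy] := connect2_connect1 xb b_y.
by exists z; [apply: connect_trans ax xz|apply: connect_trans zy yc].
Qed.

(** Reversing both stretches puts them in the wrong order; transitivity sorts them again. *)
Let step12_sym a b : step12 a b -> step12 b a.
Proof.
move=> [c ac cb]; apply: (@step12_trans _ c).
  by exists b => //; rewrite step2_connect_sym.
by exists a => //; rewrite step1_connect_sym.
Qed.

Let step12_1 a b : step1 e rot a b -> step12 a b.
Proof. by move=> ab; exists b => //; apply: connect1. Qed.

Let step12_2 a b : step2 e rot a b -> step12 a b.
Proof. by move=> ab; exists a => //; apply: connect1. Qed.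

Let panel_third t u : e t = e u ->
  exists2 d, panel_adj e t d & panel_adj e u d.
Proof.
move=> tu; have [d [h1 h2 h3]] := third_triangle TP tu.
by exists d; rewrite /panel_adj eq_sym ?h1 -?tu ?eqxx // eq_sym ?h2 ?h3.
Qed.

Lemma step1_total a : exists b, step1 e rot a b.
Proof.
have [d ad _] := panel_third (erefl (e (rot a))).
have [b db _] := panel_third (erefl (e (rot d))).
by exists b; apply/existsP; exists d; rewrite ad.
Qed.

Lemma step2_total a : exists b, step2 e rot a b.
Proof.
have [d ad _] := panel_third (erefl (e (rot a))).
have [b db _] := panel_third (erefl (e (rot (rot d)))).
by exists (rot b); apply/existsP; exists d; rewrite ad (rot3 TP).
Qed.

(* Triangles sharing an edge have a common successor or predecessor. *)
Let step12_e3 a b : e (rot a) = e (rot b) -> step12 a b.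
Proof.
move=> /panel_third [d ad bd]; have [c dc _] := panel_third (erefl (e (rot d))).
apply: (@step12_trans _ c); last apply: step12_sym.
  by apply: step12_1; apply/existsP; exists d; rewrite ad.
by apply: step12_1; apply/existsP; exists d; rewrite bd.
Qed.

Let step12_e1 a b : e a = e b -> step12 a b.
Proof.
move=> /panel_third [d ad bd].
have [c dc _] := panel_third (erefl (e (rot (rot d)))).
apply: (@step12_trans _ (rot (rot c))); first apply: step12_sym.
  apply: step12_1; apply/existsP; exists (rot (rot d)).
  by rewrite !(rot3 TP) panel_adjC dc panel_adjC.
apply: step12_1; apply/existsP; exists (rot (rot d)).
by rewrite !(rot3 TP) panel_adjC dc panel_adjC.
Qed.

Let step12_e2 a b : e (rot (rot a)) = e (rot (rot b)) -> step12 a b.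
Proof.
move=> /panel_third [d ad bd].
have [c dc _] := panel_third (erefl (e (rot d))).
apply: (@step12_trans _ (rot (rot c))); first apply: step12_sym.
  apply: step12_2; apply/existsP; exists (rot d).
  by rewrite !(rot3 TP) panel_adjC dc panel_adjC.
apply: step12_2; apply/existsP; exists (rot d).
by rewrite !(rot3 TP) panel_adjC dc panel_adjC.
Qed.

(** Let [b] lie between [a] and its [step2] successor [rot c]. Then [rot c] and [b] have the same
    second coordinate, while [b] and [rot a] have the same first one. *)
Let step12_rot a : step12 a (rot a).
Proof.
have [b ab _] := panel_third (erefl (e (rot a))).
have [c bc _] := panel_third (erefl (e (rot (rot b)))).
have ac : step12 a (rot c).
  by apply: step12_2; apply/existsP; exists b; rewrite ab (rot3 TP).
apply: step12_trans ac _; apply: (@step12_trans _ b).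
  by apply: step12_e2; rewrite (rot3 TP); case/andP: bc => /eqP.
by apply: step12_sym; apply: step12_e1; case/andP: ab => /eqP.
Qed.

Lemma step12_all a b : step12 a b.
Proof.
have [/eqP/eqP|] := eqVneq (e a) (e b); first exact: step12_e1.
(* The triangles [t] and [u] share the line through the points [e a] and [e b]; rotating them twice
   brings these points into first position. *)
move/(join_points TP) => [t [u [tu ta ub]]].
have r2 x : step12 x (rot (rot x)) by apply: step12_trans (step12_rot _) _.
apply: (@step12_trans _ (rot (rot t))); first exact: step12_e1.
apply: (@step12_trans _ t); first exact/step12_sym/r2.
apply: (@step12_trans _ u); first exact: step12_e1.
by apply: step12_trans (r2 _) _; apply: step12_e1.
Qed.

Lemma step_paths a b : exists p q, [/\ 0 < size p, 0 < size q,
  path (step1 e rot) a p, path (step2 e rot) (last a p) q &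
  last (last a p) q = b].
Proof.
have [c ac cb] := step12_all a b.
(* One arbitrary step of each kind is made and then undone by symmetry, so that neither stretch is
   empty. *)
have [a' aa'] := step1_total a; have [b' bb'] := step2_total c.
have : connect (step1 e rot) a' c.
  by apply: connect_trans ac; rewrite step1_connect_sym connect1.
have : connect (step2 e rot) b' b.
  by apply: connect_trans cb; rewrite step2_connect_sym connect1.
move=> /connectP [q qP ->] /connectP [p pP cE].
by exists (a' :: p), (b' :: q); rewrite /= -cE aa' bb'.
Qed.

End TrianglePresentation.

(** * Apartments of a building of type A~_2 *)

Import Order.TTheory GRing.Theory Num.Theory.
Local Open Scope classical_set_scope.
Local Open Scope ring_scope.

(** * The root lattice of the tiled plane *)

Definition A2_roots : seq (int * int) :=
  [:: (1, 0); (-1, 0); (0, 1); (0, -1); (1, -1); (-1, 1)].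

Lemma lattice_adjE m m' : lattice_adj m m' = (m - m' \in A2_roots).
Proof. by []. Qed.

(** When [k] is a common neighbour, [m - k] and [n - k] are roots, and questions about them become
    finite checks. *)
Lemma lattice_adj_sub m n k :
  lattice_adj m n = ((m - k) - (n - k) \in A2_roots).
Proof. by rewrite lattice_adjE opprB addrA subrK. Qed.

Lemma lattice_adjC m m' : lattice_adj m m' = lattice_adj m' m.
Proof.
have half n n' : lattice_adj n n' -> lattice_adj n' n.
  rewrite !lattice_adjE -(opprB n n'); move: (n - n') => r.
  by apply: (allP (_ : all (fun r => - r \in A2_roots) A2_roots)).
by apply/idP/idP; apply: half.
Qed.

Lemma adjacentC (V : Type) (K : set (set V)) u v :
  adjacent K u v -> adjacent K v u.
Proof. by case=> uv Kuv; split; [exact/nesym|rewrite setUC]. Qed.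

Lemma complex_isoP (V W : Type) (K : set (set V)) (L : set (set W)) f :
  complex_iso K L f ->
  set_inj (vertices K) f /\
  forall S, L S <-> exists2 S0, K S0 & f @` S0 = S.
Proof. by move=> [fi <-]; split. Qed.

Lemma vertices_tiled_plane m : m \in vertices tiled_plane.
Proof. by apply/mem_set; split; [exists m|move=> _ _ -> ->; left]. Qed.

Lemma tiled_plane_face S T : tiled_plane S -> T `<=` S -> T !=set0 ->
  tiled_plane T.
Proof. by move=> [_ h] TS T0; split=> // m m' /TS Sm /TS; apply: h. Qed.

Lemma complex_iso_reparam (V : Type) (A : set (set V)) f L Li :
  cancel L Li -> cancel Li L ->
  (forall m m', lattice_adj (L m) (L m') = lattice_adj m m') ->
  complex_iso tiled_plane A f -> complex_iso tiled_plane A (f \o L).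
Proof.
move=> LK LiK Ladj [fi <-]; split.
  move=> m m' _ _ /fi E; apply: (can_inj LK); apply: E.
  - exact: vertices_tiled_plane.
  - exact: vertices_tiled_plane.
apply/seteqP; split=> S /= [S0 [S00 hS] <-].
  exists (L @` S0); last by rewrite image_comp.
  split; first by case: S00 => m Sm; exists (L m), m.
  move=> _ _ [m Sm <-] [m' Sm' <-]; rewrite Ladj.
  by case: (hS m m' Sm Sm') => [->|]; [left|right].
exists (Li @` S0).
  split; first by case: S00 => m Sm; exists (Li m), m.
  move=> _ _ [m Sm <-] [m' Sm' <-].
  rewrite -Ladj !LiK.
  by case: (hS m m' Sm Sm') => [->|]; [left|right].
rewrite image_comp; apply: eq_imagel => m _ /=; by rewrite LiK.
Qed.

Lemma A2_roots_all2 (P : int * int -> int * int -> bool) :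
  all (fun r => all (P r) A2_roots) A2_roots ->
  forall r s, r \in A2_roots -> s \in A2_roots -> P r s.
Proof. by move=> /allP h r s /h /allP; apply. Qed.

Lemma A2_roots_all3 (P : int * int -> int * int -> int * int -> bool) :
  all (fun r => all (fun s => all (P r s) A2_roots) A2_roots) A2_roots ->
  forall r s t, r \in A2_roots -> s \in A2_roots -> t \in A2_roots -> P r s t.
Proof. by move=> h r s t hr hs ht; apply: (allP (A2_roots_all2 h hr hs)). Qed.

Definition lin_comb (u v d : int * int) : int * int :=
  (d.1 * u.1 + d.2 * v.1, d.1 * u.2 + d.2 * v.2).

Definition lin_det (u v : int * int) : int := u.1 * v.2 - u.2 * v.1.

(* The determinant is its own inverse. *)
Definition lin_comb_inv (u v d : int * int) : int * int :=
  (lin_det u v * (v.2 * d.1 - v.1 * d.2),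
   lin_det u v * (u.1 * d.2 - u.2 * d.1)).

Section LatticeMap.
Context (m0 u v : int * int).
Context (ru : u \in A2_roots) (rv : v \in A2_roots) (ruv : u - v \in A2_roots).

Let det2 : lin_det u v * lin_det u v = 1.
Proof.
suff : (u - v \in A2_roots) ==> (lin_det u v * lin_det u v == 1).
  by rewrite ruv => /eqP.
by move: u v ru rv; apply: A2_roots_all2; vm_compute.
Qed.

Let lin_combK : cancel (lin_comb u v) (lin_comb_inv u v).
Proof.
move=> [x y]; rewrite /lin_comb_inv /lin_comb /=; congr pair.
  by transitivity (lin_det u v * lin_det u v * x);
    [rewrite /lin_det; ring|rewrite det2 mul1r].
by transitivity (lin_det u v * lin_det u v * y);
  [rewrite /lin_det; ring|rewrite det2 mul1r].
Qed.

Let lin_combVK : cancel (lin_comb_inv u v) (lin_comb u v).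
Proof.
move=> [x y]; rewrite /lin_comb_inv /lin_comb /=; congr pair.
  by transitivity (lin_det u v * lin_det u v * x);
    [rewrite /lin_det; ring|rewrite det2 mul1r].
by transitivity (lin_det u v * lin_det u v * y);
  [rewrite /lin_det; ring|rewrite det2 mul1r].
Qed.

Let lin_comb_root d : (lin_comb u v d \in A2_roots) = (d \in A2_roots).
Proof.
have key r s t : r \in A2_roots -> s \in A2_roots -> t \in A2_roots ->
    (r - s \in A2_roots) ==> (lin_comb r s t \in A2_roots) &&
                          (lin_comb_inv r s t \in A2_roots).
  by apply: (A2_roots_all3 (P := fun r s t => _ ==> _)); vm_compute.
have {}key t : t \in A2_roots -> (lin_comb u v t \in A2_roots) &&
                              (lin_comb_inv u v t \in A2_roots).
  by move=> ht; have := key u v t ru rv ht; rewrite ruv.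
by apply/idP/idP => /key /andP[]//; rewrite lin_combK.
Qed.

Let lin_comb_sub d d' : lin_comb u v d - lin_comb u v d' = lin_comb u v (d - d').
Proof.
case: d d' => [x y] [x' y']; rewrite /lin_comb /=.
by apply/eqP; rewrite /eq_op /=; apply/andP; split; apply/eqP; ring.
Qed.

(** Brings a triangle of a chart into standard position: [u] and [v] form a basis of determinant 1
    or -1, and the linear map preserves the set of roots. *)
Lemma lattice_map : exists L Li, [/\ cancel L Li, cancel Li L,
  forall m m', lattice_adj (L m) (L m') = lattice_adj m m' &
  [/\ L (0, 0) = m0, L (1, 0) = m0 + u & L (0, 1) = m0 + v]].
Proof.
exists (fun d => m0 + lin_comb u v d), (fun d => lin_comb_inv u v (d - m0)).
split=> [d|d|d d'|].
- by rewrite addrC addKr lin_combK.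
- by rewrite lin_combVK addrC subrK.
- by rewrite !lattice_adjE opprD addrACA subrr add0r lin_comb_sub lin_comb_root.
split; rewrite /lin_comb /= !(mul0r, mul1r, addr0, add0r) -?surjective_pairing //.
Qed.

End LatticeMap.

(** * Charts, triangles and chambers *)

Section Building.
Context (V : Type) (B : A2_building V).

Lemma building_face S T : simplices B S -> T `<=` S -> T !=set0 ->
  simplices B T.
Proof. by case: (building_complex B) => _; apply. Qed.

Lemma simplex_adjacent C u v : simplices B C -> C u -> C v -> u <> v ->
  adjacent B u v.
Proof.
move=> BC Cu Cv uv; split=> //; apply: building_face BC _ _.
  by move=> _ [->|->].
by exists u; left.
Qed.

Lemma apartment_face A S T : apartments B A -> A S -> T `<=` S -> T !=set0 ->
  A T.
Proof.
move=> /apartment_plane [f /complex_isoP [fi fA]] /fA [S0 tS <-] TS T0.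
apply/fA; exists (S0 `&` f @^-1` T).
  apply: tiled_plane_face tS _ _; first by move=> x [].
  by case: T0 => t Tt; have [m Sm E] := TS t Tt; exists m; split=> //=; rewrite E.
apply/seteqP; split=> [_ [m [_ Tm] <-] //|t Tt].
by have [m Sm E] := TS t Tt; exists m => //; split=> //=; rewrite E.
Qed.

(* Two apartments with two common vertices induce the same adjacency between
   them. *)
Lemma apartment_full A u v : apartments B A -> A [set u] -> A [set v] ->
  adjacent B u v -> A [set u; v].
Proof.
move=> apA Au Av [uv Buv].
have [A1 [apA1 A1uv _]] := apartment_common Buv Buv.
have A1u : A1 [set u].
  by apply: apartment_face apA1 A1uv _ _; [move=> _ ->; left|exists u].
have A1v : A1 [set v].
  by apply: apartment_face apA1 A1uv _ _; [move=> _ ->; right|exists v].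
have [f /complex_isoP [fi fA] fix_uv] := apartment_iso apA apA1 Au Av A1u A1v.
have fu : f u = u by apply: fix_uv; left.
have fv : f v = v by apply: fix_uv; right.
have /fA [S0 AS0 E] := A1uv.
have inA w : S0 w -> w \in vertices A.
  move=> S0w; apply/mem_set; apply: apartment_face apA AS0 _ _.
    by move=> _ ->.
  by exists w.
suff -> : [set u; v] = S0 by [].
apply/seteqP; split=> w.
  move=> wuv; have : (f @` S0) w by rewrite E.
  move=> [w' S0w' fw']; suff <- : w' = w by [].
  apply: fi; [exact: inA| |].
    by apply/mem_set; case: wuv => ->.
  by rewrite fw'; case: wuv => ->.
move=> S0w; have : [set u; v] (f w) by rewrite -E; exists w.
by case=> [fw|fw]; [left|right]; apply: fi; rewrite ?fu ?fv //;
  first [exact: inA | exact/mem_set].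
Qed.

Section Chart.
Context (A : set (set V)) (f : int * int -> V).
Context (apA : apartments B A) (isoA : complex_iso tiled_plane A f).

Lemma chart_inj : injective f.
Proof.
by case: isoA => fi _ m m' /fi; apply; apply: vertices_tiled_plane.
Qed.

Lemma chart_range S v : A S -> S v -> exists m, v = f m.
Proof.
by case: (complex_isoP isoA) => _ fA /fA [S0 _ <-] [m _ <-]; exists m.
Qed.

Lemma chart_apartment S0 : A (f @` S0) <-> tiled_plane S0.
Proof.
case: (complex_isoP isoA) => _ fA; split=> [/fA [S1 tS1 E]|tS0].
  suff <- : S1 = S0 by [].
  apply/seteqP; split=> m Sm.
    have : (f @` S0) (f m) by rewrite -E; exists m.
    by move=> [m' Sm' /chart_inj <-].
  have : (f @` S1) (f m) by rewrite E; exists m.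
  by move=> [m' Sm' /chart_inj <-].
by apply/fA; exists S0.
Qed.

Lemma chart_simplex S0 : tiled_plane S0 -> simplices B (f @` S0).
Proof. by move/chart_apartment/(apartment_sub apA). Qed.

Lemma chart_adjacent m m' : adjacent B (f m) (f m') <-> lattice_adj m m'.
Proof.
have im n n' : [set f n; f n'] = f @` [set n; n'] by rewrite image_setU !image_set1.
have Af n : A [set f n].
  rewrite -(image_set1 f); apply/chart_apartment; split; first by exists n.
  by move=> _ _ -> ->; left.
split=> [ad|ad].
  have := apartment_full apA (Af m) (Af m') ad.
  rewrite im => /chart_apartment [_ h].
  have [E|//] := h m m' (or_introl erefl) (or_intror erefl).
  by case: ad => ne; rewrite E in ne.
split.
  move=> /chart_inj E; move: ad; rewrite E lattice_adjE subrr.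
  by vm_compute.
rewrite im; apply: chart_simplex; split; first by exists m; left.
by move=> n n' [->|->] [->|->]; rewrite ?[lattice_adj m' m]lattice_adjC; auto.
Qed.

End Chart.

Lemma chart_exists S T : simplices B S -> simplices B T -> exists f,
  [/\ injective f, forall m m', adjacent B (f m) (f m') <-> lattice_adj m m',
      forall S0, tiled_plane S0 -> simplices B (f @` S0),
      forall v, S v \/ T v -> exists m, v = f m &
      exists2 A, apartments B A & complex_iso tiled_plane A f].
Proof.
move=> BS BT; have [A [apA AS AT]] := apartment_common BS BT.
have [f isoA] := apartment_plane apA; exists f; split.
- exact: chart_inj isoA.
- exact: chart_adjacent apA isoA.
- by move=> S0; exact: (chart_simplex apA isoA).
- by move=> v [Sv|Tv]; [apply: (chart_range isoA AS)|apply: (chart_range isoA AT)].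
- by exists A.
Qed.

Lemma edge_chart o u v : adjacent B o u -> adjacent B o v -> exists f,
  [/\ injective f, forall m m', adjacent B (f m) (f m') <-> lattice_adj m m' &
  exists m a b, [/\ f m = o, f a = u & f b = v]].
Proof.
move=> [_ Bou] [_ Bov].
have [f [fi fa _ fr _]] := chart_exists Bou Bov; exists f; split=> //.
have [m mE] := fr o (or_introl (or_introl erefl)).
have [a aE] := fr u (or_introl (or_intror erefl)).
have [b bE] := fr v (or_intror (or_intror erefl)).
by exists m, a, b.
Qed.

(** An apartment containing the edge and the vertex [w] sees all three adjacencies, and every clique
    of its plane is a simplex. *)
Lemma triangle_simplex u v w : adjacent B u v -> adjacent B v w ->
  adjacent B u w -> simplices B [set u; v; w].
Proof.
move=> uv vw uw; have [f [_ fa ft fr _]] := chart_exists uv.2 (building_vertices B w).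
have [a aE] := fr u (or_introl (or_introl erefl)).
have [b bE] := fr v (or_introl (or_intror erefl)).
have [c cE] := fr w (or_intror erefl).
move: uv vw uw; rewrite aE bE cE => /fa ab /fa bc /fa ac.
rewrite -!image_set1 -!image_setU; apply: ft; split; first by exists a; left; left.
by move=> m m' [[->|->]|->] [[->|->]|->]; auto;
  right; rewrite lattice_adjC.
Qed.

(** A further vertex of a larger simplex would give four mutually adjacent vertices in one plane. *)
Lemma triangle_chamber u v w : adjacent B u v -> adjacent B v w ->
  adjacent B u w -> chamber B [set u; v; w].
Proof.
move=> uv vw uw; split; first exact: triangle_simplex.
move=> S BS sub; apply/seteqP; split=> // s Ss.
have Su : S u by apply: sub; left; left.
have Sv : S v by apply: sub; left; right.
have Sw : S w by apply: sub; right.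
have [su|su] := pselect (s = u); first by left; left.
have [sv|sv] := pselect (s = v); first by left; right.
have [sw|sw] := pselect (s = w); first by right.
have as_ := simplex_adjacent BS Ss.
have [f [fi fa _ fr _]] := chart_exists BS BS.
have [a aE] := fr u (or_introl Su); have [b bE] := fr v (or_introl Sv).
have [c cE] := fr w (or_introl Sw); have [d dE] := fr s (or_introl Ss).
move: (uv) (vw) (uw) (as_ _ Su su) (as_ _ Sv sv) (as_ _ Sw sw).
rewrite aE bE cE dE !fa => ab bc ac da db dc.
have hx : b - a \in A2_roots by rewrite -lattice_adjE lattice_adjC.
have hy : c - a \in A2_roots by rewrite -lattice_adjE lattice_adjC.
have hz : d - a \in A2_roots by [].
move: bc db dc; rewrite !(lattice_adj_sub _ _ a).
move: (b - a) (c - a) (d - a) hx hy hz => x y z hx hy hz hxy hzx hzy.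
suff /implyP : (x - y \in A2_roots) ==> ~~ ((z - x \in A2_roots) && (z - y \in A2_roots)).
  by move=> /(_ hxy); rewrite hzx hzy.
move: x y z {hxy hzx hzy} hx hy hz.
by apply: (A2_roots_all3 (P := fun x y z => (x - y \in A2_roots) ==> _)); vm_compute.
Qed.

Lemma edge_third u v : adjacent B u v ->
  exists2 w, adjacent B u w & adjacent B v w.
Proof.
move=> uv; have [f [_ fa [m [a [b [mE aE _]]]]]] := edge_chart uv uv.
move: uv; rewrite -mE -aE => /fa; rewrite lattice_adjC lattice_adjE => ma.
have [r hr hr'] : exists2 r, r \in A2_roots & r - (a - m) \in A2_roots.
  apply/hasP; move: (a - m) ma; apply/allP; by vm_compute.
exists (f (r + m)); apply/fa; rewrite lattice_adjC lattice_adjE ?addrK //.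
by rewrite opprB addrA in hr'; rewrite -addrA [m - a]addrC addrA addrAC.
Qed.

Lemma chamber_edge C u v : chamber B C -> C u -> C v -> adjacent B u v ->
  exists w, [/\ C = [set u; v; w], adjacent B u w & adjacent B v w].
Proof.
move=> [BC maxC] Cu Cv uv.
(* A chamber inside the edge would not be maximal, since the edge lies in a triangle. *)
have [w Cw [uw vw]] : exists2 w, C w & u <> w /\ v <> w.
  apply: contrapT => no.
  have subC : C `<=` [set u; v].
    move=> x Cx; have [->|ux] := pselect (x = u); first by left.
    have [->|vx] := pselect (x = v); first by right.
    by case: no; exists x => //; split; apply: nesym.
  have [w uw vw] := edge_third uv; apply: no; exists w; last by case: uw vw => ? _ [].
  rewrite -(maxC [set u; v; w]); first by right.
    exact: triangle_simplex.
  by move=> x /subC ?; left.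
have auw := simplex_adjacent BC Cu Cw uw.
have avw := simplex_adjacent BC Cv Cw vw.
exists w; split=> //; have [_ h] := triangle_chamber uv avw auw.
by apply: h => // _ [[->|->]|->].
Qed.

Lemma thick_third u v w w' : thick B -> adjacent B u v ->
  exists x, [/\ adjacent B u x, adjacent B v x, x <> w & x <> w'].
Proof.
move=> thB uv; apply: contrapT => no; have := thB _ _ uv.
set X := [set C | chamber B C /\ _] => leX.
(* If [w] and [w'] were the only third vertices, the chambers on the edge would be indexed by two
   elements, whereas thickness gives three. *)
have subX : X `<=` (fun i : nat => [set u; v; if i == 0%N then w else w']) @` `I_2.
  move=> C [chC sub]; have [x [-> ux vx]] := chamber_edge chC
    (sub u (or_introl erefl)) (sub v (or_intror erefl)) uv.
  have [->|xw] := pselect (x = w); first by exists 0%N.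
  have [->|xw'] := pselect (x = w'); first by exists 1%N.
  by case: no; exists x.
have := card_le_trans leX (card_le_trans (subset_card_le subX) (card_image_le _ _)).
by rewrite card_le_II.
Qed.

(** One apartment contains the triangles [o u w] and [o v w'], hence all adjacencies of the supposed
    4-cycle; but the link of [o] in it is a hexagon. *)
Lemma no_4cycle o u w v w' : adjacent B o u -> adjacent B o v ->
  adjacent B o w -> adjacent B o w' -> adjacent B u w -> adjacent B v w ->
  adjacent B u w' -> adjacent B v w' -> u <> v -> w = w'.
Proof.
move=> ou ov ow ow' uw vw uw' vw' nuv; apply: contrapT => nww'.
have [f [fi fa _ fr _]] := chart_exists (triangle_simplex ou uw ow)
  (triangle_simplex ov vw' ow').
have [m mE] := fr o (or_introl (or_introl (or_introl erefl))).
have [a aE] := fr u (or_introl (or_introl (or_intror erefl))).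
have [b bE] := fr w (or_introl (or_intror erefl)).
have [c cE] := fr v (or_intror (or_introl (or_intror erefl))).
have [d dE] := fr w' (or_intror (or_intror erefl)).
move: ou ov ow ow' uw vw uw' vw'; rewrite mE aE bE cE dE !fa.
rewrite ![lattice_adj m _]lattice_adjC [lattice_adj a b](lattice_adj_sub _ _ m).
rewrite [lattice_adj c b](lattice_adj_sub _ _ m).
rewrite [lattice_adj a d](lattice_adj_sub _ _ m).
rewrite [lattice_adj c d](lattice_adj_sub _ _ m) !lattice_adjE.
have ac : a - m != c - m by apply/eqP => /addIr E; apply: nuv; rewrite aE cE E.
have bd : b - m != d - m by apply/eqP => /addIr E; apply: nww'; rewrite bE dE E.
move: (a - m) (b - m) (c - m) (d - m) ac bd => x z y t xy zt hx hy hz ht.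
move=> hxz hyz hxt hyt.
have key : all (fun x => all (fun y => (x != y) ==> all (fun z => all (fun t =>
   [&& x - z \in A2_roots, y - z \in A2_roots, x - t \in A2_roots & y - t \in A2_roots] ==>
     (z == t)) A2_roots) A2_roots) A2_roots) A2_roots by vm_compute.
move/allP/(_ x hx)/allP/(_ y hy): key; rewrite xy => /allP/(_ z hz)/allP/(_ t ht).
by rewrite hxz hyz hxt hyt (negPf zt).
Qed.

(* An apartment through the first and the last triangle of the strip contains
   the middle one. *)
Lemma strip_chart v00 v10 v01 v11 v20 :
  adjacent B v00 v10 -> adjacent B v00 v01 -> adjacent B v10 v01 ->
  adjacent B v10 v11 -> adjacent B v01 v11 -> adjacent B v10 v20 ->
  adjacent B v11 v20 -> v00 <> v11 -> v01 <> v20 ->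
  exists f, [/\ exists2 A, apartments B A & complex_iso tiled_plane A f,
    f (0, 0) = v00, f (1, 0) = v10, f (0, 1) = v01 &
    f (1, 1) = v11 /\ f (2, 0) = v20].
Proof.
move=> h1 h2 h3 h4 h5 h6 h7 n1 n2.
have [f [fi fa _ fr [A apA isoA]]] := chart_exists (triangle_simplex h1 h3 h2)
  (triangle_simplex h4 h7 h6).
have [a aE] := fr v00 (or_introl (or_introl (or_introl erefl))).
have [b bE] := fr v10 (or_introl (or_introl (or_intror erefl))).
have [c cE] := fr v01 (or_introl (or_intror erefl)).
have [d dE] := fr v11 (or_intror (or_introl (or_intror erefl))).
have [e eE] := fr v20 (or_intror (or_intror erefl)).
move: h1 h2 h3 h4 h5 h6 h7 n1 n2; rewrite aE bE cE dE eE !fa.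
rewrite [lattice_adj a b]lattice_adjC [lattice_adj a c]lattice_adjC.
rewrite [lattice_adj b c](lattice_adj_sub _ _ a).
move=> h1 h2 h3 h4 h5 h6 h7 n1 n2.
(* The map [L] puts the first triangle into standard position. Adjacency then leaves one place for
   [v11] and after it one for [v20], the two inequalities excluding the folded positions. *)
have [L [Li [LK LiK Ladj [L0 L1 L2]]]] := lattice_map a h1 h2 h3.
rewrite addrC subrK in L1; rewrite addrC subrK in L2.
have corner m : lattice_adj (1, 0) m -> lattice_adj (0, 1) m -> m != (0, 0) ->
    m = (1, 1).
  rewrite lattice_adjC lattice_adjE => hm.
  rewrite -[m](subrK (1, 0)); move: (m - (1, 0)) hm => r hr.
  rewrite lattice_adjE => h h0; apply/eqP; move: h h0.
  suff : ((0, 1) - (r + (1, 0)) \in A2_roots) ==> (r + (1, 0) != (0, 0)) ==>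
    (r + (1, 0) == (1, 1)) by move=> /implyP h /h /implyP.
  by move: r hr; apply/allP; vm_compute.
have next m : lattice_adj (1, 0) m -> lattice_adj (1, 1) m -> m != (0, 1) ->
    m = (2, 0).
  rewrite lattice_adjC lattice_adjE => hm.
  rewrite -[m](subrK (1, 0)); move: (m - (1, 0)) hm => r hr.
  rewrite lattice_adjE => h h0; apply/eqP; move: h h0.
  suff : ((1, 1) - (r + (1, 0)) \in A2_roots) ==> (r + (1, 0) != (0, 1)) ==>
    (r + (1, 0) == (2, 0)) by move=> /implyP h /h /implyP.
  by move: r hr; apply/allP; vm_compute.
have L3 : L (1, 1) = d.
  suff <- : Li d = (1, 1) by rewrite LiK.
  apply: corner; [by rewrite -Ladj LiK L1|by rewrite -Ladj LiK L2|].
  by apply/eqP => E; apply: n1; rewrite -(LiK d) E L0.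
have L4 : L (2, 0) = e.
  suff <- : Li e = (2, 0) by rewrite LiK.
  apply: next; [by rewrite -Ladj LiK L1|by rewrite -Ladj LiK L3|].
  by apply/eqP => E; apply: n2; rewrite -(LiK e) E L2.
exists (f \o L); split=> /=; rewrite ?L0 ?L1 ?L2 ?L3 ?L4 //.
by exists A => //; apply: complex_iso_reparam LK LiK Ladj isoA.
Qed.

(** * Types around a vertex *)

Section Types.
Context (tau : V -> 'Z_3) (tau_type : type_function B tau).

Lemma adjacent_type u v : adjacent B u v -> tau u <> tau v.
Proof.
move=> uv E; have [w uw vw] := edge_third uv.
have [x [_ h]] := tau_type (triangle_chamber uv vw uw) (tau u).
have xu : x = u by apply: h; split=> //; left; left.
have xv : x = v by apply: h; split; [left; right|].
by case: uv => + _; apply; rewrite -xu.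
Qed.

(** Around a vertex of type [t0] only two types occur and they alternate, so three steps lead to the
    other type. *)
Lemma Z3_hexagon (t0 t1 t2 t3 t4 : 'Z_3) : t1 != t0 -> t2 != t0 -> t3 != t0 ->
  t4 != t0 -> t1 != t2 -> t2 != t3 -> t3 != t4 -> t1 != t4.
Proof.
by move: t0 t1 t2 t3 t4; do 5!case=> [[|[|[|//]]] ?].
Qed.

(** In an apartment the link of [o] is a hexagon. Distinct vertices of equal type in it are neither
    adjacent nor opposite, because types alternate; so they are at distance two. *)
Lemma common_neighbour o u v : adjacent B o u -> adjacent B o v -> u <> v ->
  tau u = tau v -> exists w, [/\ adjacent B o w, adjacent B u w & adjacent B v w].
Proof.
move=> ou ov uv tuv.
have [f [fi fa [m [a [b [mE aE bE]]]]]] := edge_chart ou ov.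
have ma : a - m \in A2_roots by rewrite -lattice_adjE lattice_adjC -fa mE aE.
have mb : b - m \in A2_roots by rewrite -lattice_adjE lattice_adjC -fa mE bE.
have ab : a - m != b - m.
  by apply/eqP => /addIr E; apply: uv; rewrite -aE -bE E.
have fm r s : adjacent B (f (r + m)) (f (s + m)) <-> r - s \in A2_roots.
  by rewrite fa lattice_adjE opprD addrACA subrr addr0.
have f0 r : adjacent B o (f (r + m)) <-> r \in A2_roots.
  by rewrite -mE fa lattice_adjC lattice_adjE addrK.
rewrite -aE -bE -[a](subrK m) -[b](subrK m) in tuv *.
have nab : a - m - (b - m) \notin A2_roots.
  by apply/negP => /fm /adjacent_type.
move: (a - m) (b - m) ma mb ab nab tuv => r s hr hs rs nrs tuv.
pose mid r s := has (fun t => (r - t \in A2_roots) && (s - t \in A2_roots)) A2_roots.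
pose opp r s := has (fun p => has (fun q => [&& r - p \in A2_roots,
  p - q \in A2_roots & q - s \in A2_roots]) A2_roots) A2_roots.
have key : [|| r == s, r - s \in A2_roots, mid r s | opp r s].
  by move: r s hr hs {rs nrs tuv}; apply: A2_roots_all2; vm_compute.
move: key; rewrite (negPf rs) (negPf nrs) /= => /orP [].
  move=> /hasP [t ht /andP [h1 h2]].
  by exists (f (t + m)); split; [apply/f0|apply/fm|apply/fm].
move=> /hasP [p hp /hasP [q hq /and3P [h1 h2 h3]]].
have ne x y : adjacent B x y -> tau x != tau y.
  by move=> xy; apply/eqP; apply: adjacent_type.
have neo x : x \in A2_roots -> tau (f (x + m)) != tau o.
  by move=> /f0/ne; rewrite eq_sym.
have := Z3_hexagon (neo _ hr) (neo _ hp) (neo _ hq) (neo _ hs)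
  (ne _ _ ((fm _ _).2 h1)) (ne _ _ ((fm _ _).2 h2)) (ne _ _ ((fm _ _).2 h3)).
by rewrite tuv eqxx.
Qed.

End Types.

End Building.

(** * Labellings *)

Lemma mulmx_gt0 (R : realDomainType) (m n p : nat) (A : 'M[R]_(m, n))
    (A' : 'M[R]_(n, p)) i j k :
  (forall i j, 0 <= A i j) -> (forall i j, 0 <= A' i j) ->
  0 < A i j -> 0 < A' j k -> 0 < (A *m A') i k.
Proof.
move=> A0 A'0 Aij A'jk; rewrite mxE (bigD1 j) //=.
by apply: ltr_wpDr; [apply: sumr_ge0 => l _; apply: mulr_ge0|apply: mulr_gt0].
Qed.

Lemma mulmx_ge0 (R : realDomainType) (m n p : nat) (A : 'M[R]_(m, n))
    (A' : 'M[R]_(n, p)) :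
  (forall i j, 0 <= A i j) -> (forall i j, 0 <= A' i j) ->
  forall i j, 0 <= (A *m A') i j.
Proof.
by move=> A0 A'0 i j; rewrite mxE; apply: sumr_ge0 => l _; apply: mulr_ge0.
Qed.

Lemma expmx_ge0 (R : realDomainType) (n : nat) (A : 'M[R]_n) (k : nat) :
  (forall i j, 0 <= A i j) -> forall i j, 0 <= (A ^+ k) i j.
Proof.
move=> A0; elim: k => [|k IH] i j; last by rewrite exprS; apply: mulmx_ge0.
by rewrite expr0 mxE ler0n.
Qed.

Lemma path_expmx_gt0 (R : realDomainType) (T : finType)
    (A : 'M[R]_#|T|) (r : rel T) :
  (forall i j, 0 <= A i j) ->
  (forall a b, r a b -> 0 < A (enum_rank a) (enum_rank b)) ->
  forall a p, path r a p ->
    0 < (A ^+ size p) (enum_rank a) (enum_rank (last a p)).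
Proof.
move=> A0 Ar a p; elim: p a => [|b p IH] a /=.
  by rewrite expr0 mxE eqxx ltr01.
move=> /andP [ab bp]; rewrite exprS; apply: mulmx_gt0 (Ar _ _ ab) (IH _ bp) => //.
exact: expmx_ge0.
Qed.

(** * The group action and its triangle presentation *)

Section Action.
Context (V : Type) (B : A2_building V) (tau : V -> 'Z_3)
  (Gamma : groupType) (act : Gamma -> V -> V) (o : V)
  (B_thick : thick B) (B_locally_finite : locally_finite B)
  (tau_type : type_function B tau)
  (act_action : left_action act)
  (act_aut : forall g, automorphism B (act g) /\ type_rotating tau (act g))
  (act_free : free_action act) (act_transitive : transitive_action act).

Local Notation "g ~~> h" := (adjacent B (act g o) (act h o) /\
  tau (act h o) = tau (act g o) + 1) (at level 70).
Local Notation T := (labelling B tau act o).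

Let act1 v : act 1%g v = v. Proof. by case: act_action. Qed.
Let actM g h v : act (g * h)%g v = act g (act h v).
Proof. by case: act_action. Qed.

Let act_inj g h : act g o = act h o -> g = h.
Proof.
move=> e; have /act_free : act (h^-1 * g)%g o = o by rewrite actM e -actM mulVg act1.
by move=> /(congr1 (fun k => h * k)%g); rewrite mulVKg mulg1.
Qed.

(** A type rotating automorphism adds the same constant to both types. *)
Let arrow_mul k g h : g ~~> h -> (k * g)%g ~~> (k * h)%g.
Proof.
have [[/bij_inj inj simp] [i rot]] := act_aut k.
move=> [[ne Bgh] tgh]; rewrite !actM !rot tgh addrAC; split=> //; split.
  by move=> /inj.
by have /simp := Bgh; rewrite image_setU !image_set1.
Qed.

Let generatorsP x : generators B tau act o x <-> 1%g ~~> x.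
Proof.
by rewrite /generators /= act1; split=> -[h1 h2]; split=> //; exact: adjacentC.
Qed.

Let arrowP g h : g ~~> h <-> generators B tau act o (g^-1 * h)%g.
Proof.
rewrite generatorsP; split=> [/(@arrow_mul g^-1%g)|/(@arrow_mul g)].
  by rewrite mulVg.
by rewrite mulg1 mulVKg.
Qed.

Let arrow_gen g x : generators B tau act o x -> g ~~> (g * x)%g.
Proof. by move=> Px; apply/arrowP; rewrite mulKg. Qed.

Let labelP (t : T) : triangle_labellings B tau act o (val t).
Proof.
have [h _] := @labellingE _ _ B tau act o (val t) B_locally_finite act_action act_free.
by apply: h; exists t.
Qed.

Let label_exists a : triangle_labellings B tau act o a ->
  exists t : T, val t = a.
Proof.
by have [] := @labellingE _ _ B tau act o a B_locally_finite act_action act_free.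
Qed.

Let triangle_exists g h k : g ~~> h -> h ~~> k -> k ~~> g ->
  exists t : T, val t = (g^-1 * h, h^-1 * k, k^-1 * g)%g.
Proof.
move=> /arrowP gh /arrowP hk /arrowP kg; apply: label_exists; split=> //=.
by rewrite -!mulgA !mulVKg mulVg.
Qed.

(** Only one type remains for [w], which forces the triangle to be oriented cyclically. *)
Let third_arrow g h w : g ~~> h -> adjacent B (act g o) w ->
  adjacent B (act h o) w -> exists k, [/\ act k o = w, h ~~> k & k ~~> g].
Proof.
move=> [gh tgh] gw hw; have [k kE] := act_transitive o w; exists k.
have tg := adjacent_type tau_type gw; have th := adjacent_type tau_type hw.
have [E1 E2] : tau w = tau (act h o) + 1 /\ tau (act g o) = tau w + 1.
  move: tgh tg th; move: (tau w) (tau (act g o)) (tau (act h o)) => a b c ->.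
  move=> /eqP + /eqP; suff : [forall a : 'Z_3, [forall b : 'Z_3,
    (b != a) ==> (b + 1 != a) ==> (a == b + 1 + 1) && (b == a + 1)]].
    by move=> /forallP/(_ a)/forallP/(_ b)/implyP F /F /implyP F' /F' /andP [/eqP ? /eqP].
  by apply/forallP => x; apply/forallP => y; move: x y; do 2!case=> [[|[|[|//]]] ?].
by rewrite kE; split=> //; split=> //; apply: adjacentC.
Qed.

Let rot_exists : exists rot : T -> T, forall t,
  val (rot t) = ((val t).2, (val t).1.1, (val t).1.2).
Proof.
suff /choice [rot rotE] : forall t : T, exists t' : T,
  val t' = ((val t).2, (val t).1.1, (val t).1.2) by exists rot.
move=> t; have [P1 P2 P3 E] := labelP t.
apply: label_exists; split=> //=.
have -> : (val t).2 = ((val t).1.1 * (val t).1.2)^-1%g.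
  by apply: (mulgI ((val t).1.1 * (val t).1.2)%g); rewrite E mulgV.
by rewrite -mulgA mulVg.
Qed.

Let label_eq (t u : T) : (val t).1.1 = (val u).1.1 ->
  (val t).1.2 = (val u).1.2 -> t = u.
Proof.
move=> e1 e2; apply: val_inj; have [_ _ _] := labelP t; have [_ _ _] := labelP u.
case: (val t) (val u) e1 e2 => [[a b] c] [[a' b'] c'] /= -> -> Eu Et.
by congr pair; apply: (mulgI (a' * b')%g); rewrite Eu.
Qed.

Let label_arrow1 (t : T) g : g ~~> (g * (val t).1.1)%g.
Proof. by apply: arrow_gen; case: (labelP t). Qed.

Let label_arrow2 (t : T) g : g ~~> (g * (val t).1.2)%g.
Proof. by apply: arrow_gen; case: (labelP t). Qed.

Let label_arrow3 (t : T) g : (g * (val t).1.1 * (val t).1.2)%g ~~> g.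
Proof.
have [_ _ P3 E] := labelP t; have := arrow_gen (g * (val t).1.1 * (val t).1.2)%g P3.
rewrite (_ : (g * _ * _ * _)%g = g) //.
by rewrite -!mulgA [X in (g * X)%g]mulgA E mulg1.
Qed.

Definition first_label (t : T) : Gamma := (val t).1.1.

Section Rot.
Context (rot : T -> T)
  (rotE : forall t, val (rot t) = ((val t).2, (val t).1.1, (val t).1.2)).
Let e := first_label.

Let e2E t : e (rot (rot t)) = (val t).1.2.
Proof. by rewrite /e /first_label !rotE. Qed.

(** This is the link of the vertex 1: the point x is the neighbour x, the line y is the neighbour
    y^-1, and the triangle on 1, y^-1, x has labelling (y, x, z). *)
Lemma labelling_presentation : triangle_presentation e rot.
Proof.
have P1 (t : T) : 1%g ~~> e t by have := label_arrow1 t 1%g; rewrite mul1g.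
have P2 (t : T) : 1%g ~~> (val t).1.2 by have := label_arrow2 t 1%g; rewrite mul1g.
have PV (t : T) : (e t)^-1%g ~~> 1%g by have := label_arrow1 t (e t)^-1%g; rewrite mulVg.
have P3 (t : T) : (val t).1.2 ~~> (e t)^-1%g.
  by have := label_arrow3 t (e t)^-1%g; rewrite mulVg mul1g.
split.
- move=> t; apply: val_inj; rewrite !rotE /=.
  by case: (val t) => [[]].
- move=> t u; rewrite /e /first_label !rotE /= => e1 e3.
  apply: label_eq => //; have [_ _ _] := labelP t; have [_ _ _] := labelP u.
  rewrite e1 e3 => Eu Et; apply: (mulgI (val u).1.1); apply: (mulIg (val u).2).
  by rewrite Et.
- move=> t u tu.
  (* Two points are neighbours of 1 of equal type; their common neighbour [k] in the link is the
     line named [k^-1]. *)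
  have uv : act (e t) o <> act (e u) o by move=> /act_inj; apply/eqP.
  have [w [ow tw uw]] := common_neighbour tau_type (P1 t).1 (P1 u).1 uv
    (etrans (P1 t).2 (esym (P1 u).2)).
  have [k [kw tk k1]] := third_arrow (P1 t) ow tw.
  have [k' [k'w uk _]] := third_arrow (P1 u) ow uw.
  have kk' : k' = k by apply: act_inj; rewrite kw.
  rewrite kk' in uk.
  have [t' t'E] := triangle_exists k1 (P1 t) tk.
  have [u' u'E] := triangle_exists k1 (P1 u) uk.
  by exists t', u'; rewrite !e2E /e /first_label t'E u'E /= invg1 !mul1g.
- move=> t u tu.
  (* Dually for two lines, where the common neighbour [k] itself names the common point. *)
  have uv : act (e t)^-1%g o <> act (e u)^-1%g o.
    by move=> /act_inj/invg_inj; apply/eqP.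
  have tauV : tau (act (e t)^-1%g o) = tau (act (e u)^-1%g o).
    by apply: (addIr 1); rewrite -(PV t).2 -(PV u).2.
  have [w [ow tw uw]] := common_neighbour tau_type (adjacentC (PV t).1)
    (adjacentC (PV u).1) uv tauV.
  have [k [kw k1 tk]] := third_arrow (PV t) tw ow.
  have [k' [k'w _ uk]] := third_arrow (PV u) uw ow.
  have kk' : k' = k by apply: act_inj; rewrite kw.
  rewrite kk' in uk.
  have [t' t'E] := triangle_exists (PV t) k1 tk.
  have [u' u'E] := triangle_exists (PV u) k1 uk.
  by exists t', u'; rewrite !e2E /e /first_label t'E u'E /= !mulg1 !invgK.
- move=> t u t' u' tu tu'; rewrite !e2E => tt' uu' ne.
  (* Two lines through two points would form a 4-cycle in the link of 1. *)
  apply: invg_inj; apply: act_inj.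
  apply: (no_4cycle (o := act 1%g o) (u := act (val t).1.2 o)
    (v := act (val u).1.2 o)).
  + exact: (P2 t).1.
  + exact: (P2 u).1.
  + exact: adjacentC (PV t).1.
  + exact: adjacentC (PV t').1.
  + exact: (P3 t).1.
  + by rewrite tu; exact: (P3 u).1.
  + by rewrite tt'; exact: (P3 t').1.
  + by rewrite tu' uu'; exact: (P3 u').1.
  + by move=> /act_inj; apply/eqP.
- move=> t u tu.
  (* The vertices to avoid are the third vertices of [t] and [u], both placed on the edge from 1 to
     [e t]. *)
  have [w [ow tw n1 n2]] := thick_third (act (e t * (val t).1.2)%g o)
    (act (e t * (val u).1.2)%g o) B_thick (P1 t).1.
  have [k [kw tk k1]] := third_arrow (P1 t) ow tw.
  have [d dE] := triangle_exists (P1 t) tk k1.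
  have d1 : e d = e t by rewrite /e /first_label dE /= invg1 mul1g.
  exists d; split=> //; apply/eqP => /(congr1 (fun x : T => (val x).1.2)).
    by rewrite dE /= => E; apply: n1; rewrite -kw -E mulVKg.
  by rewrite dE /= => E; apply: n2; rewrite -kw -E mulVKg.
Qed.

(** * Apartment charts realizing the steps *)

Let chart_labels (f : int * int -> V) : exists phi : int * int -> Gamma,
  forall m, act (phi m) o = f m.
Proof.
have /choice [phi phiE] : forall m, exists g, act g o = f m.
  by move=> m; apply: act_transitive.
by exists phi.
Qed.

(** With 1 at position (0,0), the elements [g10], [g01], [g11] sit at (1,0), (0,1), (1,1). The
    opposite corners 1 and [g11] differ because [rot a] and [d] do. *)
Lemma diamond_arrows a d : panel_adj e (rot a) d ->
  let g10 := (val a).1.2 in let g01 := ((val a).1.1^-1)%g in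
  let g11 := (g01 * (val d).1.2)%g in
  [/\ 1%g ~~> g10, g01 ~~> 1%g, g10 ~~> g01, g01 ~~> g11 &
      [/\ g11 ~~> g10, act 1%g o <> act g11 o, g01 = (g10 * (val d).1.1)%g &
          (g11 * (val d).2)%g = g10]].
Proof.
rewrite /panel_adj /e /first_label !rotE /= => /andP [/eqP ad /eqP nad].
have [_ _ Pa3 Ea] := labelP a; have [_ _ _ Ed] := labelP d.
have g01E : ((val a).1.1^-1)%g = ((val a).1.2 * (val d).1.1)%g.
  by rewrite -ad; apply: (mulgI (val a).1.1); rewrite mulgV mulgA Ea.
split.
- by have := label_arrow2 a 1%g; rewrite mul1g.
- by have := label_arrow1 a ((val a).1.1^-1)%g; rewrite mulVg.
- by rewrite g01E -ad; apply: arrow_gen.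
- exact: label_arrow2.
split=> //; first by rewrite g01E; apply: label_arrow3.
  move=> /act_inj E; apply: nad; apply: label_eq; rewrite rotE //=.
  by apply: (mulgI ((val a).1.1^-1)%g); rewrite mulVg.
by rewrite g01E -!mulgA [X in ((val a).1.2 * X)%g]mulgA Ed mulg1.
Qed.

(** Position (2,0) is taken by [g10] times the second coordinate of [b]. That it differs from [g01]
    expresses [rot d != b], and [strip_chart] then applies. *)
Lemma step1_chart a b : step1 e rot a b -> exists phi,
  [/\ apartment_chart B act o phi, triangle_label phi (0, 0) (val a) &
      triangle_label phi (1, 0) (val b)].
Proof.
case/existsP => d /andP [/diamond_arrows].
set g10 := (val a).1.2; set g01 := ((val a).1.1^-1)%g.
set g11 := (g01 * (val d).1.2)%g.
move=> [r1 r2 r3 r4 [r5 n1 g01E g11E]].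
rewrite /panel_adj /e /first_label !rotE /= => /andP [/eqP db /eqP ndb].
have r6 := label_arrow2 b g10.
have r7 : (g10 * (val b).1.2)%g ~~> g11.
  by have := label_arrow3 b g11; rewrite -db g11E.
have n2 : act g01 o <> act (g10 * (val b).1.2)%g o.
  move=> /act_inj; rewrite g01E => /mulgI E; apply: ndb; apply: label_eq;
    by rewrite rotE.
have [f [[A apA isoA] f00 f10 f01 [f11 f20]]] := strip_chart r1.1
  (adjacentC r2.1) r3.1 (adjacentC r5.1) r4.1 r6.1 (adjacentC r7.1) n1 n2.
have [phi phiE] := chart_labels f; exists phi.
have val_phi m g : f m = act g o -> phi m = g.
  by rewrite -phiE => /act_inj.
have {}f00 := val_phi _ _ f00; have {}f10 := val_phi _ _ f10.
have {}f01 := val_phi _ _ f01; have {}f11 := val_phi _ _ f11.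
have {}f20 := val_phi _ _ f20.
split; first by exists A => //; rewrite (funext phiE).
  rewrite /triangle_label (_ : (0, 0) + (0, 1) = (0, 1)) //.
  by rewrite (_ : (0, 0) + (1, 0) = (1, 0)) // f00 f01 f10 !mul1g.
rewrite /triangle_label (_ : (1, 0) + (0, 1) = (1, 1)) //.
rewrite (_ : (1, 0) + (1, 0) = (2, 0)) // f10 f11 f20 -db; split=> //.
by rewrite -g11E mulgK.
Qed.

Lemma step2_chart a b : step2 e rot a b -> exists phi,
  [/\ apartment_chart B act o phi, triangle_label phi (0, 0) (val a) &
      triangle_label phi (0, 1) (val b)].
Proof.
case/existsP => d /andP [/diamond_arrows].
set g10 := (val a).1.2; set g01 := ((val a).1.1^-1)%g.
set g11 := (g01 * (val d).1.2)%g.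
move=> [r1 r2 r3 r4 [r5 n1 g01E g11E]].
rewrite /panel_adj !e2E => /andP [/eqP db /eqP ndb].
(* The vertex at position (0,2); the first coordinate of a labelling enters inverted. *)
pose g02 := (g01 * (val b).1.1^-1)%g.
have r6 : g02 ~~> g01 by have := label_arrow1 b g02; rewrite mulgVK.
have r7 : g11 ~~> g02 by have := label_arrow3 b g02; rewrite mulgVK -db.
have n2 : act g10 o <> act g02 o.
  move=> /act_inj E; apply: ndb; congr (rot (rot _)); apply: label_eq => //.
  apply: (mulgI g10); rewrite -g01E -[g01](mulgVK (val b).1.1) -/g02 -E //.
have [f [[A apA isoA] f00 f01 f10 [f11 f02]]] := strip_chart (adjacentC r2.1)
  r1.1 (adjacentC r3.1) r4.1 (adjacentC r5.1) (adjacentC r6.1) r7.1 n1 n2.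
(* The strip now runs in the second direction, so the chart from [strip_chart] is reflected by
   exchanging the coordinates. *)
pose swap (m : int * int) := (m.2, m.1).
have swapK : cancel swap swap by case.
have swap_adj m m' : lattice_adj (swap m) (swap m') = lattice_adj m m'.
  rewrite !lattice_adjE (_ : swap m - swap m' = swap (m - m')) //.
  have swap_root r : r \in A2_roots -> swap r \in A2_roots.
    by move: r; apply/allP; vm_compute.
  by apply/idP/idP => /swap_root; rewrite ?swapK.
have [phi phiE] := chart_labels (f \o swap); exists phi.
have val_phi m g : f m = act g o -> phi (swap m) = g.
  by move=> fm; apply: act_inj; rewrite phiE /= swapK.
have {}f00 := val_phi _ _ f00; have {}f10 := val_phi _ _ f10.
have {}f01 := val_phi _ _ f01; have {}f11 := val_phi _ _ f11.
have {}f02 := val_phi _ _ f02; rewrite /swap /= in f00 f10 f01 f11 f02.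
split.
- exists A => //; rewrite (funext phiE).
  exact: (complex_iso_reparam swapK swapK swap_adj isoA).
- rewrite /triangle_label (_ : (0, 0) + (0, 1) = (0, 1)) //.
  by rewrite (_ : (0, 0) + (1, 0) = (1, 0)) // f00 f01 f10 !mul1g.
rewrite /triangle_label (_ : (0, 1) + (0, 1) = (0, 2)) //.
by rewrite (_ : (0, 1) + (1, 0) = (1, 1)) // f01 f11 f02 -db.
Qed.

End Rot.

Let transition_ge0 d i j : 0 <= transition_mx B tau act o d i j.
Proof. by rewrite mxE; case: asboolP. Qed.

Let transition_gt0 d (a b : T) : (exists phi,
  [/\ apartment_chart B act o phi, triangle_label phi (0, 0) (val a) &
      triangle_label phi d (val b)]) ->
  0 < transition_mx B tau act o d (enum_rank a) (enum_rank b).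
Proof. by move=> h; rewrite mxE !enum_rankK; case: asboolP. Qed.

Lemma transition_irreducible (alpha beta : T) : exists r s : nat,
  [/\ (0 < r)%N, (0 < s)%N &
    0 < (transition_mx B tau act o (1, 0) ^+ r *m
         transition_mx B tau act o (0, 1) ^+ s)
        (enum_rank alpha) (enum_rank beta)].
Proof.
have [rot rotE] := rot_exists.
have [p [q [p0 q0 pP qP <-]]] :=
  step_paths (labelling_presentation rotE) alpha beta.
exists (size p), (size q); split=> //.
(* The end of the [step1] path is the intermediate index whose term is positive. *)
apply: (@mulmx_gt0 _ _ _ _ _ _ _ (enum_rank (last alpha p))).
- exact: expmx_ge0.
- exact: expmx_ge0.
- by apply: path_expmx_gt0 pP => // a b ab; apply/transition_gt0/(step1_chart rotE).
- by apply: path_expmx_gt0 qP => // a b ab; apply/transition_gt0/(step2_chart rotE).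
Qed.

End Action.

Theorem mainTheorem2 (V : Type) (B : A2_building V) (tau : V -> 'Z_3)
  (Gamma : groupType) (act : Gamma -> V -> V) (o : V)
  (B_thick : thick B) (B_locally_finite : locally_finite B)
  (tau_type : type_function B tau)
  (act_action : left_action act)
  (act_aut : forall g, automorphism B (act g) /\ type_rotating tau (act g))
  (act_free : free_action act) (act_transitive : transitive_action act)
  (alpha beta : labelling B tau act o) :
  let M1 := transition_mx B tau act o (1, 0)%R in
  let M2 := transition_mx B tau act o (0, 1)%R in
  exists r s : nat, [/\ (0 < r)%N, (0 < s)%N &
    (0 < (M1 ^+ r *m M2 ^+ s) (enum_rank alpha) (enum_rank beta))%R].
Proof. by move=> M1 M2; apply: transition_irreducible. Qed.
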